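(* Let $k\geq 1$ and $n\geq 0$. The Munarini graph $M_{n,k}$ is isomorphic to $\Gamma_{n,k}^\star$. In particular, if $n\geq 1$, then $M_{n,k}$ is isomorphic to a subgraph of the Fibonacci cube $\Gamma_{kn-1}$.
   Context: For integers $k\geq 1$, $n\geq 0$, a $k$-generalized Pell string of length $n$ is a word of length $n$ over the alphabet $\{0,1,\ldots,k\}$ in which every maximal run of the character $k$ has even length (equivalently, a concatenation of letters from $\{0,1,\ldots,k-1,kk\}$). Let $\mathcal{F}_{n,k}$ be the set of these strings (for $n=0$ it contains only the empty string). The Munarini graph $M_{n,k}$ is the simple graph with vertex set $\mathcal{F}_{n,k}$ in which two vertices are adjacent if one of them can be obtained from the other either by replacing one occurrence of $0$ with some $i\in\{1,\ldots,k-1\}$, or by replacing one substring $00$ (two consecutive positions) with $kk$ (both replacements may be read in either direction, and both strings must be in $\mathcal{F}_{n,k}$). The Fibonacci cube $\Gamma_m$ is the subgraph of the hypercube $Q_m$ (vertex set $\{0,1\}^m$, two strings adjacent iff they differ in exactly one coordinate) induced by the binary strings of length $m$ with no two consecutive $1$s; $\Gamma_0=K_1$. Let $A_0=0^k$ and $A_i=0^{i-1}10^{k-i}$ for $i\in\{1,\ldots,k\}$ (binary strings of length $k$). A Munarini string is a binary string that is a concatenation of zero or more strings from $\{A_0,A_1,\ldots,A_{k-1},A_kA_0\}$. Let $\mathcal{F}_{n,k}^\star$ be the set of Munarini strings of length $kn$ (they have no two consecutive $1$s), and let $\Gamma_{n,k}^\star$ be the subgraph of $\Gamma_{kn}$ induced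 by $\mathcal{F}_{n,k}^\star$. *)

(* Defs.v *)
From HB Require Import structures.
From mathcomp Require Import all_boot.

Set Implicit Arguments.
Unset Strict Implicit.
Unset Printing Implicit Defensive.

Record sgraph := SGraph {
  vertex :> finType;
  adj : rel vertex;
  adj_sym : symmetric adj;
  adj_irr : irreflexive adj }.

Definition isomorphic (G H : sgraph) : Prop :=
  exists f : G -> H, bijective f /\ forall x y, adj (f x) (f y) = adj x y.

Section Subgraphs.
Variable G : sgraph.

Section Induced.
Variable P : pred G.
Definition induced_adj : rel {x : G | P x} := fun x y => adj (val x) (val y).
Lemma induced_sym : symmetric induced_adj.
Proof. by move=> x y; apply: adj_sym. Qed.
Lemma induced_irr : irreflexive induced_adj.
Proof. by move=> x; apply: adj_irr. Qed.
Definition induced : sgraph := SGraph induced_sym induced_irr.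
End Induced.

(* Not necessarily induced: any set of vertices, with any set of edges of G   *)
(* between them.                                                              *)
Record subgraph := Subgraph {
  sub_vertices : {set G};
  sub_adj : rel G;
  sub_adj_sym : symmetric sub_adj;
  sub_adj_edge : forall x y, sub_adj x y -> adj x y;
  sub_adj_vertices :
    forall x y, sub_adj x y -> (x \in sub_vertices) && (y \in sub_vertices) }.

Section ToSgraph.
Variable H : subgraph.
Definition subgraph_adj : rel {x : G | x \in sub_vertices H} :=
  fun x y => sub_adj H (val x) (val y).
Lemma subgraph_sym : symmetric subgraph_adj.
Proof. by move=> x y; apply: sub_adj_sym. Qed.
Lemma subgraph_irr : irreflexive subgraph_adj.
Proof. by move=> x; apply/negP => /sub_adj_edge; rewrite adj_irr. Qed.
Definition sgraph_of_subgraph : sgraph := SGraph subgraph_sym subgraph_irr.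
End ToSgraph.
End Subgraphs.

Coercion sgraph_of_subgraph : subgraph >-> sgraph.

Section Munarini.
Variables n k : nat.
Implicit Types w : n.-tuple 'I_k.+1.

(* The letter k is ord_max : 'I_k.+1. The positions p with i <= p < j form a  *)
(* maximal run of it.                                                         *)
Definition max_run w (i j : nat) : bool :=
  [&& i < j,
      [forall p : 'I_n, (i <= p < j) ==> (tnth w p == ord_max)] &
      [forall p : 'I_n, (p.+1 == i) || (p == j :> nat) ==>
                        (tnth w p != ord_max)]].

Definition pell_string w : bool :=
  [forall i : 'I_n.+1, forall j : 'I_n.+1, max_run w i j ==> ~~ odd (j - i)].

Definition replace_letter : rel (n.-tuple 'I_k.+1) := fun w w' =>
  [exists p : 'I_n,
    [&& tnth w p == ord0, 0 < tnth w' p < k &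
        [forall q : 'I_n, (q != p) ==> (tnth w' q == tnth w q)]]].

Definition replace_pair : rel (n.-tuple 'I_k.+1) := fun w w' =>
  [exists p : 'I_n, exists p' : 'I_n,
    [&& p' == p.+1 :> nat,
        tnth w p == ord0, tnth w p' == ord0,
        tnth w' p == ord_max, tnth w' p' == ord_max &
        [forall q : 'I_n, (q != p) && (q != p') ==> (tnth w' q == tnth w q)]]].

Definition replace : rel (n.-tuple 'I_k.+1) :=
  fun w w' => replace_letter w w' || replace_pair w w'.

Definition munarini_adj : rel {w : n.-tuple 'I_k.+1 | pell_string w} :=
  fun x y => replace (val x) (val y) || replace (val y) (val x).

Lemma munarini_sym : symmetric munarini_adj.
Proof. by move=> x y; apply: orbC. Qed.

Lemma munarini_irr : 0 < k -> irreflexive munarini_adj.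
Proof.
move=> k_gt0 x; rewrite /munarini_adj orbb; apply/negP => /orP[].
  by case/existsP=> p /and3P[/eqP->].
case/existsP=> p /existsP[p' /and5P[_ /eqP-> _ /eqP/(congr1 val)/= k0 _]].
by rewrite -k0 in k_gt0.
Qed.

Definition munarini_graph (k_gt0 : 0 < k) : sgraph :=
  SGraph munarini_sym (munarini_irr k_gt0).
End Munarini.

Section Hypercube.
Variable m : nat.
Definition hypercube_adj : rel (m.-tuple bool) :=
  fun x y => #|[set i | tnth x i != tnth y i]| == 1.
Lemma hypercube_sym : symmetric hypercube_adj.
Proof.
move=> x y; rewrite /hypercube_adj; congr (_ == 1); apply: eq_card => i.
by rewrite !inE eq_sym.
Qed.
Lemma hypercube_irr : irreflexive hypercube_adj.
Proof.
move=> x; rewrite /hypercube_adj (_ : [set _ | _] = set0) ?cards0 //.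
by apply/setP=> i; rewrite !inE eqxx.
Qed.
Definition hypercube : sgraph := SGraph hypercube_sym hypercube_irr.

Definition fibonacci_string (x : m.-tuple bool) : bool :=
  [forall i : 'I_m, forall j : 'I_m,
    (j == i.+1 :> nat) ==> ~~ (tnth x i && tnth x j)].

Definition fibonacci_cube : sgraph := @induced hypercube fibonacci_string.
End Hypercube.

Section MunariniStrings.
Variable k : nat.

Definition A (i : nat) : seq bool :=
  if i == 0 then nseq k false else nseq i.-1 false ++ true :: nseq (k - i) false.

(* The generators A_0, ..., A_{k-1}, A_k A_0, indexed by 0, ..., k.           *)
Definition munarini_block (i : 'I_k.+1) : seq bool :=
  if i == ord_max then A k ++ A 0 else A i.

(* At most size s generators are allowed, so that the predicate is boolean;   *)
(* no generator is empty when k >= 1, so this is no restriction: see          *)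
(* munarini_stringP.                                                          *)
Definition munarini_string (s : seq bool) : bool :=
  [exists bs : {bseq (size s) of 'I_k.+1},
    s == flatten [seq munarini_block i | i <- bs]].

Lemma size_A i : 0 < k -> i <= k -> size (A i) = k.
Proof.
move=> k_gt0 ik; rewrite /A; case: eqP => [_|/eqP i0]; first by rewrite size_nseq.
rewrite size_cat /= !size_nseq addnS -addSn prednK ?lt0n //.
by rewrite subnKC.
Qed.

Lemma size_munarini_block i : 0 < k -> 0 < size (munarini_block i).
Proof.
move=> k_gt0; rewrite /munarini_block; case: ifP => _.
  by rewrite size_cat size_A // ltn_addr.
by rewrite size_A // -ltnS.
Qed.

Lemma munarini_stringP s : 0 < k ->
  reflect (exists bs : seq 'I_k.+1, s = flatten [seq munarini_block i | i <- bs])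
          (munarini_string s).
Proof.
move=> k_gt0; apply: (iffP existsP) => [[bs /eqP E]|[bs E]]; first by exists bs.
suff sz : size bs <= size s by exists (Bseq sz); apply/eqP.
rewrite {s}E; elim: bs => //= i bs IH; rewrite size_cat.
by rewrite -add1n leq_add // size_munarini_block.
Qed.
End MunariniStrings.

Lemma munarini_string_fibonacci k m (x : m.-tuple bool) :
  0 < k -> munarini_string k x -> fibonacci_string x.
Proof.
move=> k_gt0 /(munarini_stringP _ k_gt0)[bs E].
pose R (a b : bool) := ~~ (a && b).
pose good s := path R false s && ~~ last false s.
have good_nil : good [::] by [].
have good_cat s t : good s -> good t -> good (s ++ t).
  by case/andP=> ps ls /andP[pt lt]; rewrite /good cat_path last_cat ps (negPf ls) pt.
have p0 j : path R false (nseq j false) by elim: j.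
have l0 j : last false (nseq j false) = false by elim: j.
have p1 j : path R true (nseq j false) by case: j => //= j; rewrite p0.
have l1 j : last true (nseq j false) = (j == 0) by case: j => //= j; rewrite l0.
have goodA i : i < k -> good (A k i).
  move=> ik; rewrite /good /A; case: eqP => _; first by rewrite p0 l0.
  by rewrite cat_path last_cat /= p0 l0 p1 l1 /= -lt0n subn_gt0.
have goodkk : good (A k k ++ A k 0).
  rewrite /good /A eqxx -[k == 0]negbK -lt0n k_gt0 /= subnn -catA.
  rewrite cat_path p0 l0 /= p1 last_cat /= l1.
  by rewrite -lt0n.
have : good (x : seq bool).
  rewrite E; elim: bs {E} => //= i bs IH; apply: good_cat => //.
  rewrite /munarini_block; case: eqP => // /eqP i_max; apply: goodA.
  by rewrite ltn_neqAle -ltnS ltn_ord andbT.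
case/andP=> /(pathP false) Px _; apply/forallP=> i; apply/forallP=> j.
apply/implyP=> /eqP ij; have := Px j; rewrite size_tuple ltn_ord => /(_ isT).
by rewrite ij /= -ij !(tnth_nth false).
Qed.

Definition munarini_subcube (n k : nat) : sgraph :=
  @induced (fibonacci_cube (k * n))
           (fun x => munarini_string k (val x)).

(* Main.v *)
Require Import Defs.
From mathcomp Require Import all_boot perm zify.

Set Implicit Arguments.
Unset Strict Implicit.
Unset Printing Implicit Defensive.

(** Replacing every pair [kk] of a Pell string by [k0] yields a word in which
    each letter [k] is followed by a [0], and from which the pairs [kk] can be
    recovered. Both kinds of edges of the Munarini graph become the replacement
    of one letter [0] of this reduced word by a nonzero letter. If every letter
    [i] is then encoded by [A_i], distinct letters [i] and [j] are at Hamming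
    distance [(i != 0) + (j != 0)], so that two encoded words are at distance 1
    exactly when they differ in a single letter, which is [0] in one of them.
    A reduced word does not end with [k], so its code ends with a [0], and
    dropping this last bit embeds the graph into the smaller Fibonacci cube. *)

(** * Graph embeddings *)

Definition graph_embedding (G H : sgraph) (f : G -> H) : Prop :=
  injective f /\ forall x y, adj (f x) (f y) = adj x y.

Lemma graph_embedding_comp (G H K : sgraph) (g : H -> K) (f : G -> H) :
  graph_embedding g -> graph_embedding f -> graph_embedding (g \o f).
Proof.
move=> [g_inj g_adj] [f_inj f_adj]; split; first exact: inj_comp.
by move=> x y; rewrite /= g_adj f_adj.
Qed.

Lemma inj_surj_bij (T : finType) (U : eqType) (f : T -> U) :
  injective f -> (forall y, exists x, f x = y) -> bijective f.
Proof.
move=> f_inj f_surj; have f_codom y : y \in codom f.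
  by have [x <-] := f_surj y; apply: codom_f.
by exists (fun y => iinv (f_codom y)) => [x|y]; [apply: iinv_f | apply: f_iinv].
Qed.

Lemma graph_embedding_subgraph (G H : sgraph) (f : G -> H) :
  graph_embedding f -> exists S : subgraph H, isomorphic G S.
Proof.
move=> [f_inj f_adj]; pose V := f @: [set: G].
pose e : rel H := fun x y => [&& adj x y, x \in V & y \in V].
have e_sym : symmetric e.
  by move=> x y; rewrite /e adj_sym [(x \in V) && _]andbC.
have e_adj x y : e x y -> adj x y by case/and3P.
have e_vertices x y : e x y -> (x \in V) && (y \in V) by case/and3P=> _ -> ->.
have f_in_V x : f x \in V by apply: imset_f; rewrite inE.
exists (Subgraph e_sym e_adj e_vertices).
exists (fun x => exist _ (f x) (f_in_V x)); split.
  apply: inj_surj_bij => [x y [/f_inj]|[y y_in_V]] //.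
  by have /imsetP[x _ y_fx] := y_in_V; exists x; apply: val_inj.
by move=> x y; rewrite /adj /= /subgraph_adj /= /e !f_in_V !andbT f_adj.
Qed.

(** * Hamming distance *)

Section Hamming.
Variable T : eqType.
Implicit Types s t : seq T.

Definition hamming s t : nat := count (fun p => p.1 != p.2) (zip s t).

Lemma hamming_cons x y s t :
  hamming (x :: s) (y :: t) = (x != y) + hamming s t.
Proof. by []. Qed.

Lemma hamming_sym s t : hamming s t = hamming t s.
Proof.
by elim: s t => [|x s IH] [|y t] //; rewrite !hamming_cons IH eq_sym.
Qed.

Lemma hamming_id s : hamming s s = 0.
Proof. by elim: s => // x s IH; rewrite hamming_cons IH eqxx. Qed.

Lemma hamming_cat s1 s2 t1 t2 : size s1 = size t1 ->
  hamming (s1 ++ s2) (t1 ++ t2) = hamming s1 t1 + hamming s2 t2.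
Proof. by move=> eq_size; rewrite /hamming zip_cat // count_cat. Qed.

Lemma hamming_rcons s t x y : size s = size t ->
  hamming (rcons s x) (rcons t y) = hamming s t + (x != y).
Proof. by move=> eq_size; rewrite -!cats1 hamming_cat // /hamming /= addn0. Qed.

Lemma card_neq_tnth n (x y : n.-tuple T) :
  #|[set i | tnth x i != tnth y i]| = hamming x y.
Proof.
rewrite /hamming -[in RHS](map_tnth_enum x) -[in RHS](map_tnth_enum y).
rewrite zip_map count_map cardE size_filter enumT.
by apply: eq_count => i; rewrite [LHS]inE.
Qed.

End Hamming.

Lemma hamming_indicator (T : eqType) (s : seq T) (x y : T) :
  uniq s -> x != y ->
  hamming [seq z == x | z <- s] [seq z == y | z <- s] = (x \in s) + (y \in s).
Proof.
move=> s_uniq xy.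
rewrite /hamming zip_map count_map -!(count_uniq_mem _ s_uniq).
have disjoint_xy : predI (pred1 x) (pred1 y) =1 pred0.
  by move=> z /=; case: eqVneq => // ->; apply: negPf.
rewrite -count_predUI (eq_count disjoint_xy) count_pred0 addn0.
apply: eq_count => z /=; have := disjoint_xy z.
by rewrite /=; case: (z == x); case: (z == y).
Qed.

Lemma hypercube_adjE m (x y : m.-tuple bool) :
  hypercube_adj x y = (hamming x y == 1).
Proof. by rewrite /hypercube_adj card_neq_tnth. Qed.

(** * Words differing in one factor *)

Section ReplaceFactor.
Variable T : Type.
Implicit Types x y s t : seq T.

Definition replace_factor x y s t : Prop :=
  exists a c, s = a ++ x ++ c /\ t = a ++ y ++ c.

Lemma replace_factor_cons z x y s t :
  replace_factor x y s t -> replace_factor x y (z :: s) (z :: t).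
Proof. by case=> a [c [-> ->]]; exists (z :: a), c. Qed.

Lemma replace_factorP d x y s t : size x = size y -> size s = size t ->
  replace_factor x y s t <-> exists p,
    [/\ p + size x <= size s, take (size x) (drop p s) = x,
        take (size x) (drop p t) = y &
        forall q, ~~ (p <= q < p + size x) -> nth d s q = nth d t q].
Proof.
move=> eq_xy eq_st; split=> [[a [c [-> ->]]]|[p [ps xE yE eq_outside]]].
  exists (size a); rewrite !drop_size_cat // take_size_cat //.
  rewrite eq_xy take_size_cat // -eq_xy.
  split=> // [|q q_outside]; first by rewrite !size_cat; lia.
  by rewrite !nth_cat -eq_xy; case: ltnP => // aq; case: ltnP => //; lia.
exists (take p s), (drop (p + size x) s).
have splitE u : u = take p u ++ take (size x) (drop p u) ++ drop (p + size x) u.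
  by rewrite addnC -drop_drop !cat_take_drop.
split; first by rewrite -[X in _ ++ X ++ _]xE -splitE.
rewrite [LHS]splitE yE; congr (_ ++ (_ ++ _)); apply: (@eq_from_nth _ d).
- by rewrite !size_take_min eq_st.
- move=> q; rewrite size_take_min => q_lt.
  by rewrite !nth_take ?eq_outside //; lia.
- by rewrite !size_drop eq_st.
- by move=> q _; rewrite !nth_drop eq_outside //; lia.
Qed.

Lemma take1_drop_tnth n (t : n.-tuple T) (p : 'I_n) :
  take 1 (drop p t) = [:: tnth t p].
Proof.
by rewrite (tnth_nth (tnth t p)) (drop_nth (tnth t p)) ?size_tuple //= take0.
Qed.

Lemma take2_drop_tnth n (t : n.-tuple T) (p q : 'I_n) :
  q = p.+1 :> nat -> take 2 (drop p t) = [:: tnth t p; tnth t q].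
Proof.
move=> q_p; rewrite (drop_nth (tnth t p)) ?size_tuple // -q_p.
by rewrite [take 2 _]/= take1_drop_tnth -tnth_nth.
Qed.

Lemma eq_nth_tnth (d : T) n (P : pred nat) (s t : n.-tuple T) :
  (forall q, P q -> nth d s q = nth d t q) <->
  (forall q : 'I_n, P q -> tnth s q = tnth t q).
Proof.
split=> eq_st q Pq; first by rewrite !(tnth_nth d) eq_st.
have [q_n|n_q] := ltnP q n; last by rewrite !nth_default ?size_tuple.
by have := eq_st (Ordinal q_n) Pq; rewrite !(tnth_nth d).
Qed.

Lemma replace_factor_tnthP (d : T) n (s t : n.-tuple T) x y : size x = size y ->
  replace_factor x y s t <-> exists p,
    [/\ p + size x <= n, take (size x) (drop p s) = x,
        take (size x) (drop p t) = y &
        forall q : 'I_n, ~~ (p <= q < p + size x) -> tnth s q = tnth t q].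
Proof.
move=> eq_xy; rewrite (replace_factorP d) ?size_tuple //.
pose outside p q := ~~ (p <= q < p + size x).
by split=> -[p [pn xE yE /(eq_nth_tnth d (outside p)) eq_outside]]; exists p.
Qed.

End ReplaceFactor.

(** * Runs of a letter *)

Section Runs.
Variables (T : eqType) (d x : T).
Implicit Types (y : T) (a w : seq T).

Lemma forall_tnth_run n (w : n.-tuple T) i j : j <= n ->
  [forall p : 'I_n, (i <= p < j) ==> (tnth w p == x)] =
  all (pred1 x) (drop i (take j w)).
Proof.
move=> jn; have size_run : size (drop i (take j w)) = j - i.
  by rewrite size_drop size_takel ?size_tuple.
have nth_run q : q < j - i -> nth d (drop i (take j w)) q = nth d w (i + q).
  by move=> q_lt; rewrite nth_drop nth_take //; lia.
apply/forallP/(all_nthP d) => [all_x q|all_x p].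
  rewrite size_run => q_lt; have q_n : i + q < n by lia.
  have /implyP := all_x (Ordinal q_n).
  by rewrite nth_run // (tnth_nth d) /=; apply; lia.
apply/implyP=> /andP[ip pj]; have p_run : p - i < j - i by lia.
have := all_x (p - i); rewrite size_run nth_run // subnKC // -tnth_nth.
exact.
Qed.

Hypothesis d_neq_x : d != x.

Lemma forall_tnth_run_boundary n (w : n.-tuple T) i j : i <= n ->
  [forall p : 'I_n, (p.+1 == i) || (p == j :> nat) ==> (tnth w p != x)] =
  (last d (take i w) != x) && (nth d w j != x).
Proof.
move=> i_n; apply/forallP/andP => [boundary|[last_i nth_j] p].
  have boundary_nth q : (q.+1 == i) || (q == j) -> nth d w q != x.
    have [q_n|n_q _] := ltnP q n; last by rewrite nth_default ?size_tuple.
    by have /implyP := boundary (Ordinal q_n); rewrite (tnth_nth d).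
  split; last by rewrite boundary_nth ?eqxx ?orbT.
  case: i i_n boundary_nth {boundary} => [|i] i_n boundary_nth.
    by rewrite take0.
  by rewrite (take_nth d) ?size_tuple // last_rcons boundary_nth ?eqxx.
apply/implyP; rewrite (tnth_nth d) => /orP[]/eqP p_eq; last by rewrite p_eq.
by move: last_i; rewrite -p_eq (take_nth d) ?size_tuple // last_rcons.
Qed.

(* [b] is the parity of the length of the run of [x] that [w] continues. *)
Fixpoint even_runs_from (b : bool) w : bool :=
  if w is y :: w' then
    if y == x then even_runs_from (~~ b) w'
    else ~~ b && even_runs_from false w'
  else ~~ b.

Definition trailing_run a : nat := find (predC1 x) (rev a).

Lemma trailing_run_rcons a y :
  trailing_run (rcons a y) = if y == x then (trailing_run a).+1 else 0.
Proof. by rewrite /trailing_run rev_rcons /=; case: eqP. Qed.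

(* At [j = size w], [nth d w j] is the default [d], which differs from [x]. *)
Lemma even_runs_fromP a w :
  even_runs_from (odd (trailing_run a)) w <->
  forall j, j <= size w -> nth d w j != x ->
    ~~ odd (trailing_run (a ++ take j w)).
Proof.
elim: w a => [|y w IH] a /=.
  split=> [even_a j|]; first by rewrite cats0.
  by move/(_ 0); rewrite cats0; apply.
have := IH (rcons a y); rewrite trailing_run_rcons.
case: eqP => [-> IHa|/eqP y_neq_x IHa].
  rewrite -[~~ _]/(odd _.+1) IHa.
  split=> [even_w [|j]|even_w j]; first by rewrite /= eqxx.
    by rewrite /= -cat_rcons; apply: even_w.
  by rewrite cat_rcons; apply: (even_w j.+1).
split=> [/andP[even_a /IHa even_w] [|j]|even_w]; first by rewrite cats0.
  by rewrite /= -cat_rcons; apply: even_w.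
apply/andP; split; first by have := even_w 0; rewrite cats0; apply.
by apply/IHa => j; rewrite cat_rcons; apply: (even_w j.+1).
Qed.

Lemma trailing_run_eq a m : m <= size a ->
  (trailing_run a == m) = all (pred1 x) (drop (size a - m) a) &&
                          (last d (take (size a - m) a) != x).
Proof.
move=> m_le; rewrite -{1}(cat_take_drop (size a - m) a).
rewrite /trailing_run rev_cat find_cat.
have size_m : size (drop (size a - m) a) = m by rewrite size_drop subKn.
rewrite has_rev has_predC if_neg; case: ifP => /= [_|/negbT not_all].
  rewrite size_rev size_m -[X in _ == X]addn0 eqn_add2l.
  case/lastP: (take _ _) => [|b y]; first by rewrite /= d_neq_x.
  by rewrite rev_rcons last_rcons /=; case: (y == x).
rewrite -has_predC -has_rev has_find size_rev size_m in not_all.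
exact: ltn_eqF.
Qed.

End Runs.

(** * Reduced words *)

Lemma last_scanl (T1 T2 : Type) (g : T1 -> T2 -> T1) (x : T1) (s : seq T2) :
  last x (scanl g x s) = foldl g x s.
Proof. by elim: s x => //=. Qed.

Section ReducedWords.
Variables (T : finType) (zero top : T).
Hypothesis zero_neq_top : zero != top.
Implicit Types (x y : T) (a c u w : seq T).

(* In the reduced form of a Pell string, [top] marks the first letter of a pair,
   so that the next letter of the string is [top] as well. Swapping [top] and
   [zero] there, instead of only sending [top] to [zero], makes [reduce] a
   bijection of the set of all words. *)
Definition swap_after x y : T := if x == top then tperm zero top y else y.

Definition reduce : seq T -> seq T := scanl swap_after zero.

Definition expand : seq T -> seq T := pairmap swap_after zero.

Lemma swap_afterK x : cancel (swap_after x) (swap_after x).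
Proof. by move=> y; rewrite /swap_after; case: eqP; rewrite ?tpermK. Qed.

Lemma reduceK : cancel reduce expand.
Proof. exact: (scanlK swap_afterK). Qed.

Lemma expandK : cancel expand reduce.
Proof. exact: (pairmapK swap_afterK). Qed.

Lemma size_reduce w : size (reduce w) = size w.
Proof. exact: size_scanl. Qed.

Lemma size_expand u : size (expand u) = size u.
Proof. exact: size_pairmap. Qed.

Lemma swap_after_top x : swap_after x top = if x == top then zero else top.
Proof. by rewrite /swap_after tpermR. Qed.

Lemma swap_after_id x y : x != top -> swap_after x y = y.
Proof. by rewrite /swap_after => /negPf->. Qed.

Lemma eq_scanl_swap_after x y w : (x == top) = (y == top) ->
  scanl swap_after x w = scanl swap_after y w.
Proof. by case: w => //= z w xy; rewrite /swap_after xy. Qed.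

Lemma eq_pairmap_swap_after x y u : (x == top) = (y == top) ->
  pairmap swap_after x u = pairmap swap_after y u.
Proof. by case: u => //= z u xy; rewrite /swap_after xy. Qed.

Definition reduced_from x u : bool :=
  path (fun y z => (y == top) ==> (z == zero)) x u && (last x u != top).

Definition reduced : seq T -> bool := reduced_from zero.

Lemma reduced_from_cons x y u :
  reduced_from x (y :: u) = ((x == top) ==> (y == zero)) && reduced_from y u.
Proof. by rewrite /reduced_from /= andbA. Qed.

Lemma reduced_from_cat x a c :
  reduced_from x (a ++ c) -> reduced_from (last x a) c.
Proof. by rewrite /reduced_from cat_path last_cat -andbA => /andP[_ ->]. Qed.

Lemma eq_reduced_from x y u : (x == top) = (y == top) ->
  reduced_from x u = reduced_from y u.
Proof.
by case: u => [|z u] xy; rewrite ?reduced_from_cons /reduced_from /= xy.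
Qed.

Definition reduced_block x : seq T :=
  if x == top then [:: top; zero] else [:: x].

Lemma reduced_block_cat x u : reduced (reduced_block x ++ u) = reduced u.
Proof.
rewrite /reduced /reduced_block; case: eqVneq => [_|x_neq_top] /=;
  rewrite !reduced_from_cons (negPf zero_neq_top) ?eqxx //=.
by apply: eq_reduced_from; rewrite (negPf x_neq_top) (negPf zero_neq_top).
Qed.

Lemma reduced_from_blocks x u : reduced_from x u ->
  exists bs, (if x == top then [:: top] else [::]) ++ u =
             flatten [seq reduced_block y | y <- bs].
Proof.
elim: u x => [|y u IH] x.
  by rewrite /reduced_from /= => /negPf->; exists [::].
rewrite reduced_from_cons; case: ifP => /= [_ /andP[/eqP-> /IH]|_ /IH].
  rewrite (negPf zero_neq_top) => -[bs /= ->].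
  by exists (top :: bs); rewrite /= /reduced_block eqxx.
case: eqVneq => [->|y_neq_top] [bs /= bs_eq]; first by exists bs.
by exists (y :: bs); rewrite /= bs_eq /reduced_block (negPf y_neq_top).
Qed.

Lemma reduced_blocksP u :
  reduced u <-> exists bs, u = flatten [seq reduced_block x | x <- bs].
Proof.
split=> [/reduced_from_blocks|[bs ->]]; first by rewrite (negPf zero_neq_top).
elim: bs => [|x bs IH] /=; last by rewrite reduced_block_cat.
by rewrite /reduced /reduced_from /=.
Qed.

Lemma reduced_from_scanl x w :
  reduced_from x (scanl swap_after x w) = even_runs_from top (x == top) w.
Proof.
elim: w x => //= y w IH x; rewrite reduced_from_cons IH.
case: (eqVneq y top) => [->|y_neq].
  rewrite swap_after_top.
  by case: (x == top); rewrite ?eqxx ?(negPf zero_neq_top).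
rewrite /swap_after; case: eqP => /= _; last by rewrite (negPf y_neq).
by rewrite -[X in _ == X](tpermR zero top) (inj_eq perm_inj) (negPf y_neq).
Qed.

Lemma reduced_reduce w : reduced (reduce w) = even_runs_from top false w.
Proof. by rewrite /reduced reduced_from_scanl (negPf zero_neq_top). Qed.

Definition raise_letter u u' : Prop :=
  exists2 x, x != zero & replace_factor [:: zero] [:: x] u u'.

Definition pell_replace w w' : Prop :=
  (exists2 x, (x != zero) && (x != top) &
     replace_factor [:: zero] [:: x] w w') \/
  replace_factor [:: zero; zero] [:: top; top] w w'.

Lemma foldl_swap_after_neq_top a c :
  reduced (reduce (a ++ zero :: c)) -> foldl swap_after zero a != top.
Proof.
rewrite /reduced /reduce scanl_cat => /reduced_from_cat.
by rewrite last_scanl reduced_from_scanl /= (negPf zero_neq_top) => /andP[].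
Qed.

Lemma raise_letter_reduce w w' :
  pell_replace w w' -> reduced (reduce w) ->
  raise_letter (reduce w) (reduce w').
Proof.
case=> [[x /andP[x_neq0 x_neq_top]]|] [a [c [-> ->]]].
  move=> /= /foldl_swap_after_neq_top last_a; exists x => //.
  exists (reduce a), (reduce c); rewrite /reduce /= !scanl_cat /=.
  rewrite !swap_after_id // (eq_scanl_swap_after (y := zero)) //.
  by rewrite (negPf x_neq_top) (negPf zero_neq_top).
move=> /= /foldl_swap_after_neq_top last_a; exists top; first by rewrite eq_sym.
exists (reduce a), (zero :: reduce c); rewrite /reduce /= !scanl_cat /=.
by rewrite !swap_after_top (negPf last_a) eqxx !swap_after_id.
Qed.

Lemma pell_replace_expand u u' :
  raise_letter u u' -> reduced u' -> pell_replace (expand u) (expand u').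
Proof.
case=> x x_neq0 [a [c [-> ->]]]; rewrite /reduced => /reduced_from_cat.
rewrite /= reduced_from_cons (negPf x_neq0) implybF => /andP[last_a c_reduced].
rewrite /pell_replace /expand /= !pairmap_cat /= !(swap_after_id _ last_a).
case: (eqVneq x top) c_reduced => [->|x_neq_top _].
  case: c => [|y c]; first by rewrite /reduced_from /= eqxx.
  rewrite reduced_from_cons eqxx => /andP[/eqP-> _]; right.
  exists (expand a), (expand c).
  by rewrite /= swap_after_id // /swap_after eqxx tpermL.
left; exists x; first by rewrite x_neq0.
exists (expand a), (expand c).
rewrite (@eq_pairmap_swap_after x zero) //.
by rewrite (negPf x_neq_top) (negPf zero_neq_top).
Qed.

Lemma pell_replace_reduce w w' : reduced (reduce w) -> reduced (reduce w') ->
  pell_replace w w' <-> raise_letter (reduce w) (reduce w').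
Proof.
move=> w_reduced w'_reduced; split=> [/raise_letter_reduce|]; first exact.
by move/pell_replace_expand; rewrite !reduceK; apply.
Qed.

End ReducedWords.

(** * Pell strings *)

Section PellStrings.
Variable k : nat.
Hypothesis k_gt0 : 0 < k.
Local Notation letter := 'I_k.+1.
Local Notation trailing_run := (trailing_run (ord_max : letter)).
Local Notation pell_replace := (pell_replace (ord0 : letter) ord_max).

Lemma ord0_neq_max : (ord0 : letter) != ord_max.
Proof. by rewrite -val_eqE /= eq_sym -lt0n. Qed.

Lemma max_runE n (w : n.-tuple letter) i j : i < j <= n ->
  max_run w i j =
  (trailing_run (take j w) == j - i) && (nth ord0 w j != ord_max).
Proof.
case/andP=> ij jn; have size_j : size (take j w) = j.
  by rewrite size_takel ?size_tuple.
rewrite (trailing_run_eq ord0_neq_max) ?size_j ?leq_subr // subKn ?(ltnW ij) //.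
rewrite take_takel ?(ltnW ij) // -andbA /max_run ij /=.
rewrite (forall_tnth_run ord0) // (forall_tnth_run_boundary ord0_neq_max) //.
exact: leq_trans (ltnW ij) jn.
Qed.

Lemma pell_stringE n (w : n.-tuple letter) :
  pell_string w = even_runs_from ord_max false w.
Proof.
apply/idP/idP => [/forallP even_w|/(even_runs_fromP ord0_neq_max [::]) even_w].
  apply/(even_runs_fromP ord0_neq_max [::]) => j.
  rewrite size_tuple => jn nth_j /=.
  have run_le : trailing_run (take j w) <= j.
    by rewrite (leq_trans (find_size _ _)) // size_rev size_takel ?size_tuple.
  have [->//|run_gt0] := posnP (trailing_run (take j w)).
  have run_n : j - trailing_run (take j w) < n.+1 by lia.
  have /forallP/(_ (Ordinal (jn : j < n.+1)))/implyP := even_w (Ordinal run_n).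
  rewrite /= max_runE ?subKn ?eqxx //; last by lia.
  by apply.
apply/forallP=> i; apply/forallP=> j; apply/implyP=> w_run.
have ij : i < j by case/and3P: w_run.
have jn : j <= n by rewrite -ltnS.
move: w_run; rewrite max_runE ?ij // => /andP[/eqP <- nth_j].
by apply: even_w; rewrite ?size_tuple.
Qed.

Lemma replace_letterP n (w w' : n.-tuple letter) :
  replace_letter w w' <->
  exists2 x, (x != ord0) && (x != ord_max) &
    replace_factor [:: ord0] [:: x] w w'.
Proof.
have letter_range (x : letter) : (0 < x < k) = (x != ord0) && (x != ord_max).
  by rewrite -!val_eqE /= lt0n; have := ltn_ord x; lia.
split=> [/existsP[p /and3P[/eqP w_p w'_p /forallP eq_w]]|[x x_range]].
  exists (tnth w' p); first by rewrite -letter_range.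
  apply/(replace_factor_tnthP ord0) => //; exists p.
  rewrite addn1 ltn_ord !take1_drop_tnth w_p; split=> // q q_neq_p.
  by apply/esym/eqP/(implyP (eq_w q)); rewrite -val_eqE /=; lia.
case/(replace_factor_tnthP ord0) => // p [/=]; rewrite addn1 => p_n.
rewrite -[p]/(val (Ordinal p_n)) !take1_drop_tnth.
move=> [w_p] [w'_p] /= eq_w; apply/existsP; exists (Ordinal p_n).
rewrite w_p w'_p eqxx letter_range x_range; apply/forallP=> q.
by apply/implyP; rewrite -val_eqE /= => q_neq_p; rewrite eq_w //; lia.
Qed.

Lemma replace_pairP n (w w' : n.-tuple letter) :
  replace_pair w w' <->
  replace_factor [:: ord0; ord0] [:: ord_max; ord_max] w w'.
Proof.
split.
  case/existsP=> p /existsP[p' /and5P[/eqP p'E /eqP w_p /eqP w_p' /eqP w'_p]].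
  case/andP=> /eqP w'_p' /forallP eq_w.
  apply/(replace_factor_tnthP ord0) => //; exists p.
  rewrite addn2 -p'E ltn_ord !(take2_drop_tnth _ p'E) w_p w_p' w'_p w'_p'.
  split=> // q q_outside.
  by apply/esym/eqP/(implyP (eq_w q)); rewrite -!val_eqE /= p'E; lia.
case/(replace_factor_tnthP ord0) => // p [/=]; rewrite addn2 => p_n.
have p'E : Ordinal p_n = (Ordinal (ltnW p_n)).+1 :> nat by [].
rewrite -[p]/(val (Ordinal (ltnW p_n))) !(take2_drop_tnth _ p'E).
move=> [w_p w_p'] [w'_p w'_p'] /= eq_w.
apply/existsP; exists (Ordinal (ltnW p_n)); apply/existsP; exists (Ordinal p_n).
rewrite w_p w_p' w'_p w'_p' !eqxx; apply/forallP=> q; apply/implyP.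
by rewrite -!val_eqE /= => q_outside; rewrite eq_w //; lia.
Qed.

Lemma replaceP n (w w' : n.-tuple letter) : replace w w' <-> pell_replace w w'.
Proof.
split=> [/orP[/replace_letterP|/replace_pairP]|]; [by left | by right |].
by case=> [/replace_letterP|/replace_pairP] ww'; apply/orP; [left | right].
Qed.

End PellStrings.

(** * Binary encoding *)

Section Encoding.
Variable k : nat.
Hypothesis k_gt0 : 0 < k.
Local Notation letter := 'I_k.+1.
Local Notation reduce := (reduce (ord0 : letter) ord_max).
Local Notation expand := (expand (ord0 : letter) ord_max).
Local Notation reduced := (reduced (ord0 : letter) ord_max).
Local Notation reduced_block := (reduced_block (ord0 : letter) ord_max).
Local Notation raise_letter := (raise_letter (ord0 : letter)).
Implicit Types (i j : letter) (u : seq letter).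

Lemma nth_A i p : p < k -> nth false (A k i) p = (p.+1 == i).
Proof.
move=> pk; have := ltn_ord i; rewrite /A; case: eqP => [->|i_neq0] ik.
  by rewrite nth_nseq pk.
rewrite nth_cat size_nseq nth_nseq; case: ltngtP => [p_lt|p_gt|->].
- by lia.
- by rewrite -(subnSK p_gt) /= nth_nseq; case: ifP; lia.
- by rewrite subnn /= prednK ?eqxx //; lia.
Qed.

Lemma size_A_letter i : size (A k i) = k.
Proof. by rewrite size_A // -ltnS. Qed.

Lemma A_indicator i : A k i = [seq p == i :> nat | p <- iota 1 k].
Proof.
apply: (@eq_from_nth _ false) => [|p]; rewrite size_A_letter.
  by rewrite size_map size_iota.
by move=> pk; rewrite nth_A // (nth_map 0) ?size_iota // nth_iota.
Qed.

Lemma last_A b i : last b (A k i) = (i == ord_max).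
Proof.
rewrite -nth_last (set_nth_default false) size_A_letter ?prednK //.
by rewrite nth_A ?prednK // eq_sym -val_eqE.
Qed.

Lemma hamming_A i j :
  hamming (A k i) (A k j) = (i != j) * ((i != ord0) + (j != ord0)).
Proof.
have mem_iota_letter (x : letter) : ((x : nat) \in iota 1 k) = (x != ord0).
  by rewrite mem_iota add1n ltn_ord andbT lt0n.
rewrite !A_indicator; have [->|ij] := eqVneq i j; first by rewrite hamming_id.
by rewrite hamming_indicator ?iota_uniq // !mem_iota_letter mul1n.
Qed.

Definition encode u : seq bool := flatten [seq A k (i : letter) | i <- u].

Lemma encode_cat u u' : encode (u ++ u') = encode u ++ encode u'.
Proof. by rewrite /encode map_cat flatten_cat. Qed.

Lemma size_encode u : size (encode u) = k * size u.
Proof.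
elim: u => [|i u IH]; first by rewrite muln0.
by rewrite (encode_cat [:: i]) size_cat IH /encode /= cats0 size_A_letter mulnS.
Qed.

Lemma hamming_encode_cons i j u u' :
  hamming (encode (i :: u)) (encode (j :: u')) =
  (i != j) * ((i != ord0) + (j != ord0)) + hamming (encode u) (encode u').
Proof. by rewrite /encode /= hamming_cat ?size_A_letter // hamming_A. Qed.

Lemma hamming_encode_eq0 u u' : size u = size u' ->
  hamming (encode u) (encode u') = 0 -> u = u'.
Proof.
elim: u u' => [|i u IH] [|j u'] //= [eq_size].
rewrite hamming_encode_cons => /eqP.
rewrite addn_eq0 muln_eq0 addn_eq0 !eqb0 !negbK => /andP[ij /eqP/IH-> //].
by case/orP: ij => [/eqP->|/andP[/eqP-> /eqP->]].
Qed.

Lemma encode_inj : injective encode.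
Proof.
move=> u u' eq_uu'; apply: hamming_encode_eq0; last first.
  by rewrite eq_uu' hamming_id.
by apply/eqP; rewrite -(eqn_pmul2l k_gt0) -!size_encode eq_uu'.
Qed.

Lemma hamming_encode_raise u u' :
  raise_letter u u' -> hamming (encode u) (encode u') = 1.
Proof.
case=> i i_neq0 [a [c [-> ->]]] /=.
rewrite !encode_cat hamming_cat ?size_encode //.
by rewrite hamming_encode_cons !hamming_id eqxx i_neq0 eq_sym i_neq0.
Qed.

Lemma hamming_encode_eq1 u u' : size u = size u' ->
  hamming (encode u) (encode u') = 1 -> raise_letter u u' \/ raise_letter u' u.
Proof.
elim: u u' => [|i u IH] [|j u'] //= [eq_size]; rewrite hamming_encode_cons.
have [->|ij] := eqVneq i j.
  rewrite mul0n => /(IH _ eq_size)[] [x x_neq0 uu']; [left | right];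
    by exists x => //; apply: replace_factor_cons.
rewrite mul1n => /eqP; rewrite addn_eq1.
case: (eqVneq i ord0) ij => [->|i_neq0]; case: (eqVneq j ord0) => [->|j_neq0];
  rewrite ?eqxx //= orbF => _ /eqP/(hamming_encode_eq0 eq_size)->.
- by left; exists j => //; exists [::], u'.
- by right; exists i => //; exists [::], u'.
Qed.

Lemma last_encode u : last false (encode u) = (last ord0 u == ord_max).
Proof.
case/lastP: u => [|u i]; first by rewrite (negPf (ord0_neq_max k_gt0)).
by rewrite -cats1 encode_cat !last_cat /= last_A.
Qed.

Lemma munarini_blockE i : munarini_block i = encode (reduced_block i).
Proof.
rewrite /munarini_block /reduced_block.
by case: eqP; rewrite /encode /= cats0.
Qed.

Lemma munarini_string_reducedP s :
  munarini_string k s <-> exists2 u, reduced u & s = encode u.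
Proof.
have flatten_blocks bs : flatten [seq munarini_block i | i <- bs] =
    encode (flatten [seq reduced_block i | i <- bs]).
  by elim: bs => //= i bs ->; rewrite encode_cat munarini_blockE.
split=> [/(munarini_stringP _ k_gt0)[bs ->]|[u]].
  exists (flatten [seq reduced_block i | i <- bs]) => //.
  by apply/(reduced_blocksP (ord0_neq_max k_gt0)); exists bs.
case/(reduced_blocksP (ord0_neq_max k_gt0)) => bs -> ->.
by apply/munarini_stringP => //; exists bs.
Qed.

Lemma size_pell_code n (w : n.-tuple letter) :
  size (encode (reduce w)) == k * n.
Proof. by rewrite size_encode size_reduce size_tuple. Qed.

Definition pell_code n (w : n.-tuple letter) : (k * n).-tuple bool :=
  Tuple (size_pell_code w).

Lemma pell_code_inj n : injective (@pell_code n).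
Proof.
move=> w w' /(congr1 val) /= /encode_inj eq_ww'; apply: val_inj => /=.
exact: can_inj (reduceK _ _) _ _ eq_ww'.
Qed.

Lemma reduced_reduce_pell n (w : n.-tuple letter) :
  reduced (reduce w) = pell_string w.
Proof.
by rewrite (reduced_reduce (ord0_neq_max k_gt0)) (pell_stringE k_gt0).
Qed.

Lemma pell_code_munarini n (w : n.-tuple letter) :
  pell_string w -> munarini_string k (pell_code w).
Proof.
rewrite -reduced_reduce_pell => w_reduced; apply/munarini_string_reducedP.
by exists (reduce w).
Qed.

Lemma pell_code_surj n (s : (k * n).-tuple bool) : munarini_string k s ->
  exists2 w : n.-tuple letter, pell_string w & pell_code w = s.
Proof.
case/munarini_string_reducedP => u u_reduced s_eq.
have size_u : size (expand u) == n.
  by rewrite size_expand -(eqn_pmul2l k_gt0) -size_encode -s_eq size_tuple.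
exists (Tuple size_u); first by rewrite -reduced_reduce_pell expandK.
by apply: val_inj; rewrite /= expandK.
Qed.

Lemma replace_raise_letter n (w w' : n.-tuple letter) :
  pell_string w -> pell_string w' ->
  replace w w' <-> raise_letter (reduce w) (reduce w').
Proof.
rewrite -!reduced_reduce_pell (replaceP k_gt0).
exact: (pell_replace_reduce (ord0_neq_max k_gt0)).
Qed.

Lemma pell_code_adj n (w w' : n.-tuple letter) :
  pell_string w -> pell_string w' ->
  hypercube_adj (pell_code w) (pell_code w') = replace w w' || replace w' w.
Proof.
move=> w_pell w'_pell; rewrite hypercube_adjE.
apply/eqP/orP => [/hamming_encode_eq1|].
  rewrite !size_reduce !size_tuple => /(_ erefl)[] /replace_raise_letter.
    by left; auto.
  by right; auto.
case=> /replace_raise_letter/hamming_encode_raise; first by apply.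
by rewrite hamming_sym; apply.
Qed.

End Encoding.

(** * Munarini graphs *)

Lemma munarini_graph_isomorphic k n (k_gt0 : 0 < k) :
  isomorphic (munarini_graph n k_gt0) (munarini_subcube n k).
Proof.
pose code (w : munarini_graph n k_gt0) := pell_code k_gt0 (val w).
have code_munarini w : munarini_string k (code w).
  exact: pell_code_munarini (valP w).
have code_fibonacci w : fibonacci_string (code w).
  exact: munarini_string_fibonacci (code_munarini w).
pose f w : munarini_subcube n k :=
  exist _ (exist _ (code w) (code_fibonacci w) : fibonacci_cube (k * n))
    (code_munarini w).
exists f; split=> [|w w']; last exact: pell_code_adj (valP w) (valP w').
apply: inj_surj_bij => [w w' /(congr1 (val \o val))|[[s s_fib] s_munarini]].
  by move/(@pell_code_inj k k_gt0 n)/val_inj.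
have [w w_pell s_eq] := pell_code_surj k_gt0 s_munarini.
by exists (exist _ w w_pell); do 2 apply: val_inj.
Qed.

Lemma fibonacci_string_rcons m m' (x : m.-tuple bool) (y : m'.-tuple bool) b :
  tval y = rcons x b -> fibonacci_string y -> fibonacci_string x.
Proof.
move=> yE /forallP y_fib; have m_le : m <= m'.
  by rewrite -(size_tuple y) yE size_rcons size_tuple.
have tnth_y i : tnth x i = tnth y (widen_ord m_le i).
  by rewrite !(tnth_nth false) yE nth_rcons size_tuple /= ltn_ord.
apply/forallP=> i; apply/forallP=> j; rewrite !tnth_y.
by have /forallP := y_fib (widen_ord m_le i); apply.
Qed.

Lemma rcons_take_last (T : Type) (d : T) (s : seq T) :
  0 < size s -> s = rcons (take (size s - 1) s) (last d s).
Proof.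
case/lastP: s => // s x _.
by rewrite size_rcons subn1 last_rcons -cats1 take_size_cat ?cats1.
Qed.

Lemma induced_fibonacci_cube_embedding m (P : pred (fibonacci_cube m)) :
  0 < m -> (forall x, P x -> last false (val x) = false) ->
  exists f : induced P -> fibonacci_cube (m - 1), graph_embedding f.
Proof.
move=> m_gt0 last_P.
have size_trunc (x : induced P) : size (take (m - 1) (val (val x))) == m - 1.
  by rewrite size_takel // size_tuple leq_subr.
pose trunc x := Tuple (size_trunc x).
have truncK x : tval (val (val x)) = rcons (trunc x) false.
  rewrite /= -(last_P _ (valP x)) -[X in X - 1](size_tuple (val (val x))).
  by apply: rcons_take_last; rewrite size_tuple.
have trunc_fibonacci x : fibonacci_string (trunc x).
  exact: fibonacci_string_rcons (truncK x) (valP (val x)).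
exists (fun x => exist _ (trunc x) (trunc_fibonacci x)); split=> [x y|x y].
  move/(congr1 (fun z => rcons (val (val z)) false)).
  by rewrite /= -!truncK => /val_inj/val_inj/val_inj.
rewrite /adj /= /induced_adj /= /adj /= !hypercube_adjE.
by rewrite !truncK hamming_rcons ?size_tuple // addn0.
Qed.

Lemma munarini_subcube_embedding k n : 0 < k -> 0 < n ->
  exists f : munarini_subcube n k -> fibonacci_cube (k * n - 1),
    graph_embedding f.
Proof.
move=> k_gt0 n_gt0; apply: induced_fibonacci_cube_embedding => [|x].
  by rewrite muln_gt0 k_gt0.
case/(munarini_string_reducedP k_gt0) => u u_reduced ->.
by rewrite (last_encode k_gt0); case/andP: u_reduced => _ /negPf.
Qed.

Theorem theorem3p1 (k n : nat) (k_gt0 : 0 < k) :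
  isomorphic (munarini_graph n k_gt0) (munarini_subcube n k) /\
  (0 < n -> exists H : subgraph (fibonacci_cube (k * n - 1)),
              isomorphic (munarini_graph n k_gt0) H).
Proof.
have iso := munarini_graph_isomorphic n k_gt0; split=> // n_gt0.
have [f [f_bij f_adj]] := iso.
have [g g_embedding] := munarini_subcube_embedding k_gt0 n_gt0.
apply: (graph_embedding_subgraph (f := g \o f)).
by apply: graph_embedding_comp => //; split; first exact: bij_inj.
Qed.
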